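(* Algorithm 1 (described in the context) is a 3-approximation algorithm for min-sum 2-MST: for every instance, the solution $\{T_b,T_r\}$ it returns (for any resolution of its arbitrary choices) satisfies $c(T_b)+c(T_r)\le 3\cdot\mathrm{OPT}$, where $\mathrm{OPT}$ is the minimum of $c(R)+c(B)$ over all feasible solutions.
   Context: An instance of 2-MST consists of $2n$ nodes $V$ (with $n$ even) partitioned into $n$ pairs $\{p_i,q_i\}$, together with metric edge weights $c$ on the complete graph on $V$ (nonnegative, triangle inequality). A feasible solution colors, for each $i$, one of $p_i,q_i$ red and the other blue, and consists of a spanning tree $R$ on the red nodes and a spanning tree $B$ on the blue nodes. The min-sum objective is to minimize $c(R)+c(B)$, where $c(F)$ is the total weight of an edge set $F$. Algorithm 1: (1) compute a minimum spanning tree $T$ on all $2n$ nodes; (2) delete a maximum-weight edge $e_\times$ of $T$, obtaining two trees $T_L,T_R$ on node sets $V_L,V_R$; (3) for each pair with $p_i\in V_L$ and $q_i\in V_R$ (up to renaming within the pair), color the node in $V_L$ blue and the node in $V_R$ red; (4) for every other pair, assign its two nodes arbitrary distinct colors; (5) for each color, compute a minimum spanning tree $T_b$ (resp. $T_r$) of the nodes of that color; return $\{T_b,T_r\}$. *)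

(* Defs.v *)
From HB Require Import structures.
From mathcomp Require Import all_boot all_order all_algebra.

Set Implicit Arguments.
Unset Strict Implicit.
Unset Printing Implicit Defensive.

Import Order.TTheory GRing.Theory Num.Theory.

Local Open Scope ring_scope.

(* An edge of the complete graph on V is a two-element set of nodes.  The
   weight function is defined on all of {set V}, but only its values on edges
   are ever constrained or used. *)
Record instance (R : realFieldType) := Instance {
  npairs : nat;
  node : finType;
  p : 'I_npairs -> node;
  q : 'I_npairs -> node;
  c : {set node} -> R;
  npairs_even : ~~ odd npairs;
  pairs_partition :
    bijective (fun ib : 'I_npairs * bool => if ib.2 then p ib.1 else q ib.1);
  c_ge0 : forall x y : node, x != y -> 0 <= c [set x; y];
  c_triangle : forall x y z : node, x != y -> y != z -> x != z ->
    c [set x; z] <= c [set x; y] + c [set y; z]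
}.

Section Trees.

Variable V : finType.
Implicit Types (S : {set V}) (F : {set {set V}}).

Definition adj F : rel V := [rel x y | [set x; y] \in F].

Definition edges_on S F : Prop :=
  forall e, e \in F -> #|e| = 2%N /\ e \subset S.

Definition connected_on S F : Prop := {in S &, forall x y, connect (adj F) x y}.

(* A cyclic sequence of length 2 traverses a single edge back and forth, so
   graph cycles are the duplicate-free cyclic sequences of length at least 3. *)
Definition acyclic F : Prop := forall s : seq V, ucycle (adj F) s -> (size s <= 2)%N.

Definition spanning_tree S F : Prop :=
  [/\ edges_on S F, connected_on S F & acyclic F].

End Trees.

Section TwoMST.

Variables (R : realFieldType) (I : instance R).
Notation V := (node I).
Implicit Types (S red : {set V}) (F T Tr Tb : {set {set V}}).

Definition weight F : R := \sum_(e in F) c e.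

Definition minimum_spanning_tree S T : Prop :=
  spanning_tree S T /\ forall T', spanning_tree S T' -> weight T <= weight T'.

(* A colouring is given by its set of red nodes, the blue nodes being the
   complement. *)
Definition valid_coloring red : Prop :=
  forall i : 'I_(npairs I), (p i \in red) != (q i \in red).

Definition feasible red Tr Tb : Prop :=
  [/\ valid_coloring red, spanning_tree red Tr & spanning_tree (~: red) Tb].

Definition is_min_sum_opt (opt : R) : Prop :=
  (exists red Tr Tb, feasible red Tr Tb /\ weight Tr + weight Tb = opt) /\
  (forall red Tr Tb, feasible red Tr Tb -> opt <= weight Tr + weight Tb).

Definition max_weight_edge T (e : {set V}) : Prop :=
  e \in T /\ forall f, f \in T -> c f <= c e.

Definition splits_into F (VL VR : {set V}) (TL TR : {set {set V}}) : Prop :=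
  [/\ VL :|: VR = [set: V], [disjoint VL & VR], F = TL :|: TR,
      spanning_tree VL TL & spanning_tree VR TR].

Definition colors_cut_pairs (VL VR red : {set V}) : Prop :=
  forall i : 'I_(npairs I),
    (p i \in VL -> q i \in VR -> p i \in ~: red /\ q i \in red) /\
    (q i \in VL -> p i \in VR -> q i \in ~: red /\ p i \in red).

(* The possible outputs of the algorithm, over all resolutions of its
   choices: T, e, which of the two components is called VL, the colouring of
   the pairs not separated by the cut, and the two final trees. *)
Definition algorithm_output red Tr Tb : Prop :=
  exists (T : {set {set V}}) (e : {set V}) (VL VR : {set V})
         (TL TR : {set {set V}}),
    [/\ minimum_spanning_tree [set: V] T,
        max_weight_edge T e,
        splits_into (T :\ e) VL VR TL TR,
        valid_coloring red /\ colors_cut_pairs VL VR red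
      & minimum_spanning_tree red Tr /\ minimum_spanning_tree (~: red) Tb].

End TwoMST.

(* Main.v *)
Require Import Defs.
From mathcomp Require Import all_boot all_order all_algebra.
From mathcomp Require Import lra.

(** Write [e] for the deleted edge, [TL] and [TR] for the two parts of the
    minimum spanning tree [T].

    Upper bound.  For a tree [S] rooted at [u] and any 2-colouring, connecting
    each colour class separately, plus two connections from [u] to the colour
    class not containing it, costs at most [3 c(S)] (induction over the tree);
    with a single connection it costs at most [3 c(S) - c(g)], for any edge
    [g] of [S].  Joining the two parts across [e], the algorithm pays at most
    [3 c(TL) + 3 c(TR) + 2 c(e) - c(g) - c(h)] for any [g] in [TL], [h] in
    [TR], and at most [3 c(TL) + c(TR) + c(e) - c(g)] if [TR] is monochromatic.

    Lower bound.  An edge [g] of [T] whose ends get different colours in an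
    optimal solution joins its two trees, so [OPT >= c(T) - c(g)].  If a
    part contains both nodes of some pair, such a [g] exists in that part;
    otherwise the colouring rule makes the part monochromatic.  The bounds
    combine using [c(g), c(h) <= c(e)]. *)

Set Implicit Arguments.
Unset Strict Implicit.
Unset Printing Implicit Defensive.

Import Order.TTheory GRing.Theory Num.Theory.

Local Open Scope ring_scope.

(** * Connectivity, bridges and recursive decomposition of trees *)

Section Graphs.

Variable V : finType.
Implicit Types (S : {set V}) (F T : {set {set V}}) (x y u v : V).

Lemma adjC F x y : adj F x y = adj F y x.
Proof. by rewrite /adj /= setUC. Qed.

Lemma connect_adjC F : connect_sym (adj F).
Proof. by apply: sym_connect_sym => x y; rewrite adjC. Qed.

Lemma connect_adjS F F' : F \subset F' ->
  subrel (connect (adj F)) (connect (adj F')).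
Proof.
move=> /subsetP sFF'; apply: connect_sub => x y xyF.
by apply: connect1; apply: sFF'.
Qed.

Lemma connect_invariant F (P : pred V) x y :
  (forall z t, adj F z t -> P z -> P t) -> connect (adj F) x y -> P x -> P y.
Proof.
move=> inv /connectP[s]; elim: s x => [|z s IHs] x /=; first by move=> _ ->.
by case/andP=> xz zs ey /(inv _ _ xz); apply: IHs ey.
Qed.

Lemma pair_card2 (e : {set V}) x y : e = [set x; y] -> #|e| = 2%N -> x != y.
Proof. by move=> ->; rewrite cards2; case: eqP. Qed.

Lemma edges_on_adj S F x y :
  edges_on S F -> adj F x y -> [/\ x != y, x \in S & y \in S].
Proof.
move=> eF /eF[c2 /subsetP sub]; split; first exact: pair_card2 c2.
  by apply: sub; rewrite set21.
by apply: sub; rewrite set22.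
Qed.

Lemma connect_edges_on S F x y :
  edges_on S F -> connect (adj F) x y -> x \in S -> y \in S.
Proof.
move=> eF; apply: connect_invariant => z t /(edges_on_adj eF)[//].
Qed.

Lemma connect_in S F x : edges_on S F ->
  (forall y, y \in S -> connect (adj F) x y) -> connected_on S F.
Proof.
move=> eF xS y z /xS xy /xS xz.
by apply: connect_trans xz; rewrite connect_adjC.
Qed.

Lemma set2_eq (x y z t : V) :
  [set x; y] = [set z; t] -> (x = z /\ y = t) \/ (x = t /\ y = z).
Proof.
move=> E.
have := set21 x y; have := set22 x y; rewrite E !inE.
have := set21 z t; have := set22 z t; rewrite -E !inE.
do 4!(case/orP=> /eqP ?); subst; by [left | right].
Qed.

(** The rest of the cycle, from [y] through [s] back to [x], avoids the edge since no node repeats.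
    A nonempty [s] excludes the cycle of length 2, which retraces the edge itself. *)
Lemma cycle_edge_redundant F x y s :
  ucycle (adj F) [:: x, y & s] -> s != [::] ->
  connect (adj (F :\ [set x; y])) y x.
Proof.
case/andP=> /= /andP[_]; rewrite inE negb_or -andbA.
move=> cyc /and4P[xy xs ys us] s0; apply/connectP.
exists (rcons s x); last by rewrite last_rcons.
case: s s0 cyc xs ys us => // z s _ /= /andP[yz cyc].
rewrite !inE !negb_or => /andP[xz xs] /andP[yz' ys] _.
apply/andP; split.
  rewrite /adj /= !inE; apply/andP; split=> //.
  apply/eqP => /set2_eq[[E _]|[_ E]]; first by rewrite E eqxx in xy.
  by rewrite E eqxx in xz.
(* From here on the walk never meets [y] again, so no further step can be the deleted edge. *)
elim: s z {yz xz} yz' xs ys cyc => [|t s IHs] z yz xs ys /= /andP[zt cyc].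
  rewrite andbT /adj /= !inE; apply/andP; split=> //.
  apply/eqP => /set2_eq[[_ E]|[E _]]; first by rewrite E eqxx in xy.
  by rewrite E eqxx in yz.
move: xs ys; rewrite !inE !negb_or => /andP[xt xs] /andP[yt ys].
apply/andP; split; last exact: IHs.
rewrite /adj /= !inE; apply/andP; split=> //.
apply/eqP => /set2_eq[[_ E]|[_ E]]; first by rewrite E eqxx in yt.
by rewrite E eqxx in xt.
Qed.

Lemma connected_onD1 S F x y : connected_on S F ->
  connect (adj (F :\ [set x; y])) y x -> connected_on S (F :\ [set x; y]).
Proof.
move=> cF yx u v uS vS; apply: connect_sub (cF u v uS vS) => z t zt.
case E: ([set z; t] == [set x; y]); last first.
  by apply: connect1; rewrite /adj /= !inE E.
case/eqP/set2_eq: E => [[-> ->]|[-> ->]] //.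
by rewrite connect_adjC.
Qed.

(** An inclusion-minimal connected subset of [F] is acyclic: any edge of a cycle could be removed
    without disconnecting it. *)
Lemma connected_spanning_subtree S F :
  edges_on S F -> connected_on S F ->
  exists T : {set {set V}}, T \subset F /\ spanning_tree S T.
Proof.
move=> eF cF.
pose P (T : {set {set V}}) :=
  [forall x in S, forall y in S, connect (adj T) x y].
have PP T : reflect (connected_on S T) (P T).
  apply: (iffP idP) => [/forall_inP cT x y xS yS|cT].
    by have /forall_inP := cT x xS; apply.
  by apply/forall_inP=> x xS; apply/forall_inP=> y yS; apply: cT.
have [T minT sTF] : {T | minset P T & T \subset F}.
  by apply: minset_exists; apply/PP.
have [/PP cT infT] := minsetP minT.
exists T; split=> //; split=> // [e eT|]; first exact/eF/(subsetP sTF).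
case=> [//|x [//|y [//|z s]]] cyc.
have xyT : [set x; y] \in T by case/andP: cyc => /= /andP[].
have /PP := connected_onD1 cT (cycle_edge_redundant cyc isT).
move/infT/(_ (subD1set _ _)) => E.
by move: xyT; rewrite -E !inE eqxx.
Qed.

(** A duplicate-free path from [x] to [y] avoiding the edge has an inner node, so the edge closes it
    into a cycle of length at least 3. *)
Lemma acyclic_bridge F x y : acyclic F -> x != y -> adj F x y ->
  ~~ connect (adj (F :\ [set x; y])) x y.
Proof.
move=> aF xy xyF; apply/negP=> /connectP[s0 /shortenP[s ps us _]].
case: s ps us => [|z [|t s]] /= ps us ey; first by rewrite ey eqxx in xy.
  by move: ps; rewrite -ey /adj /= !inE eqxx.
have /aF // : ucycle (adj F) [:: x, z, t & s].
rewrite /ucycle /= us andbT rcons_path.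
have sub : subrel (adj (F :\ [set x; y])) (adj F).
  by move=> a b; rewrite /adj /= !inE => /andP[].
case/and3P: ps => /sub -> /sub -> /(sub_path sub) -> /=.
by rewrite -ey adjC.
Qed.

(** Being reachable from [x] or from [y] without the edge is preserved along every edge of [F], the
    deleted one included. *)
Lemma connectD1 F x y z : connect (adj F) x z ->
  connect (adj (F :\ [set x; y])) x z || connect (adj (F :\ [set x; y])) y z.
Proof.
set F' := F :\ _ => xz.
pose P := [pred t | connect (adj F') x t || connect (adj F') y t].
apply: (connect_invariant (P := P)) xz _; last by rewrite /= connect0.
move=> a b ab /=.
case E: ([set a; b] == [set x; y]).
  by case/eqP/set2_eq: E => [[_ ->]|[_ ->]] _; rewrite connect0 ?orbT.
have ab' : connect (adj F') a b by apply: connect1; rewrite /adj /= !inE E.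
by case/orP=> /connect_trans/(_ ab') ->; rewrite ?orbT.
Qed.

Lemma acyclicS F F' : F \subset F' -> acyclic F' -> acyclic F.
Proof.
move=> /subsetP sFF' aF' s /andP[cs us]; apply: aF'; apply/andP; split=> //.
by apply: sub_cycle cs => x y; apply: sFF'.
Qed.

Lemma connect_restrict S F x y :
  (forall z t, adj F z t -> z \in S -> t \in S) -> x \in S ->
  connect (adj F) x y -> connect (adj [set e in F | e \subset S]) x y.
Proof.
move=> clS xS xy.
set F' := [set e in F | _].
pose P := [pred t | (t \in S) && connect (adj F') x t].
suff /andP[] : P y by [].
apply: (connect_invariant (P := P)) xy _; last by rewrite /= xS connect0.
move=> a b ab /andP[aS xa] /=.
have bS : b \in S by apply: clS ab aS.
rewrite bS; apply: connect_trans xa _; apply: connect1.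
by rewrite /adj /= inE subUset !sub1set aS bS !andbT; apply: ab.
Qed.

(** The two parts are the components of [u] and [v] once the edge is deleted: they are disjoint
    because the edge is a bridge, and every other edge lies inside one of them. *)
Lemma spanning_tree_split S T u v : spanning_tree S T -> adj T u v ->
  exists S1 S2 T1 T2,
    [/\ [/\ u \in S1, v \in S2, S = S1 :|: S2 & [disjoint S1 & S2]],
        T = [set u; v] |: (T1 :|: T2), spanning_tree S1 T1
      & spanning_tree S2 T2].
Proof.
case=> eT cT aT uvT; have [uv uS vS] := edges_on_adj eT uvT.
have nuv := acyclic_bridge aT uv uvT.
pose F := T :\ [set u; v].
have sFT : F \subset T by apply: subD1set.
have eF : edges_on S F by move=> e /(subsetP sFT)/eT.
pose C x := [set z | connect (adj F) x z].
have clC x z t : adj F z t -> z \in C x -> t \in C x.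
  by move=> zt; rewrite !inE => /connect_trans; apply; apply: connect1.
pose E x := [set e in F | e \subset C x].
have sC x : x \in S -> C x \subset S.
  by move=> xS; apply/subsetP=> z; rewrite inE => /(connect_edges_on eF); apply.
have tree x : x \in S -> spanning_tree (C x) (E x).
  move=> xS.
  have eE : edges_on (C x) (E x).
    by move=> e; rewrite inE => /andP[/eF[c2 _] ->].
  have xC : x \in C x by rewrite inE connect0.
  split=> //; last first.
    apply: acyclicS aT; apply/subsetP=> e; rewrite inE => /andP[eF' _].
    exact: subsetP eF'.
  apply: (connect_in (x := x)) eE _ => y; rewrite inE.
  by move=> xy; apply: connect_restrict xC xy => z t; apply: clC.
have cover z : z \in S -> (z \in C u) || (z \in C v).
  by move=> zS; rewrite !inE; apply/connectD1/cT.
exists (C u), (C v), (E u), (E v); split; [split| |exact: tree|exact: tree].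
- by rewrite inE connect0.
- by rewrite inE connect0.
- apply/eqP; rewrite eqEsubset subUset !sC // !andbT.
  by apply/subsetP=> z /cover; rewrite in_setU.
- apply/pred0P=> z /=; apply/negP=> /andP[]; rewrite !inE => uz vz.
  by case/negP: nuv; apply: connect_trans uz _; rewrite connect_adjC.
apply/setP=> e; rewrite !in_setU !inE.
have [->|ne] := eqVneq e [set u; v]; first exact: uvT.
rewrite /=; case eT': (e \in T) => //=.
have [c2 _] := eT _ eT'.
have /cards2P[x [y [_ ee]]] : #|e| == 2%N by rewrite c2.
have xyF : adj F x y by rewrite /adj /= -ee !inE ne eT'.
have [_ xS _] := edges_on_adj eF xyF.
rewrite ee !subUset !sub1set.
case/orP: (cover x xS) => xC; have yC := clC _ _ _ xyF xC.
  by rewrite xC yC.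
by rewrite xC yC orbT.
Qed.

(** Induction on rooted trees: cut an edge from the root [u] to a neighbour [v], and root the two
    smaller trees at [u] and [v]. *)
Lemma spanning_tree_ind (P : V -> {set V} -> {set {set V}} -> Prop) :
  (forall u, P u [set u] set0) ->
  (forall u v S1 S2 T1 T2,
     u \in S1 -> v \in S2 -> [disjoint S1 & S2] ->
     spanning_tree S1 T1 -> spanning_tree S2 T2 ->
     P u S1 T1 -> P v S2 T2 ->
     P u (S1 :|: S2) ([set u; v] |: (T1 :|: T2))) ->
  forall S T u, spanning_tree S T -> u \in S -> P u S T.
Proof.
move=> P0 PU S; have [n ltS] := ubnP #|S|.
elim: n S ltS => // n IHn S; rewrite ltnS => ltS T u tT uS.
have [eT cT aT] := tT.
have [v uv|noadj] := pickP (fun v => adj T u v).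
  have [S1 [S2 [T1 [T2 [[uS1 vS2 eS dS] -> tT1 tT2]]]]] :=
    spanning_tree_split tT uv.
  have cS : #|S| = (#|S1| + #|S2|)%N.
    by rewrite eS cardsU; move/disjoint_setI0: dS => ->; rewrite cards0 subn0.
  have S1gt0 : (0 < #|S1|)%N by apply/card_gt0P; exists u.
  have S2gt0 : (0 < #|S2|)%N by apply/card_gt0P; exists v.
  rewrite eS; apply: PU => //; apply: IHn => //.
    by apply: leq_trans ltS; rewrite cS -addn1 leq_add2l.
  by apply: leq_trans ltS; rewrite cS -add1n leq_add2r.
(* A root without neighbours is the whole tree. *)
have uonly z : connect (adj T) u z -> z = u.
  move=> uz; apply/eqP; apply: (connect_invariant (P := pred1 u)) uz _ => //=.
  by move=> a b ab /eqP ea; rewrite ea noadj in ab.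
have -> : S = [set u].
  apply/setP=> z; rewrite inE; apply/idP/eqP => [zS|->//].
  exact/uonly/cT.
have -> // : T = set0.
apply/setP=> e; rewrite inE; apply/negP=> eT'.
have [c2 /subsetP sS] := eT _ eT'.
have /cards2P[x [y [_ ee]]] : #|e| == 2%N by rewrite c2.
have xyT : adj T x y by rewrite /adj /= -ee.
have [_ xS _] := edges_on_adj eT xyT.
have xu := uonly _ (cT _ _ uS xS).
by rewrite xu noadj in xyT.
Qed.

Lemma crossing_edge S F (A : {set V}) x y : edges_on S F -> connected_on S F ->
  x \in S -> y \in S -> x \in A -> y \notin A ->
  exists u v, [/\ adj F u v, u \in A & v \notin A].
Proof.
move=> eF cF xS yS xA yA.
have [[u v] /and3P[uv uA vA]|none] :=
  pickP (fun uv => [&& adj F uv.1 uv.2, uv.1 \in A & uv.2 \notin A]).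
  by exists u, v.
case/negP: yA.
apply: (connect_invariant (P := [in A])) (cF x y xS yS) xA.
by move=> u v uv uA; move: (none (u, v)); rewrite /= uv uA => /negbFE.
Qed.

End Graphs.

(** * Edge weights and the induced distance *)

Section Metric.

Variables (R : realFieldType) (I : instance R).
Notation V := (node I).
Implicit Types (A S X Y VL VR red : {set V}) (F T Tr Tb TL TR : {set {set V}}).
Implicit Types (x y z u v : V).
Implicit Types (w t : R).

(** The value of [c] on a singleton is unconstrained, so the diagonal is set to 0 by hand; the
    triangle inequality then holds without distinctness conditions. *)
Definition dist x y : R := if x == y then 0 else c [set x; y].

Lemma dist_ge0 x y : 0 <= dist x y.
Proof. by rewrite /dist; case: ifPn => // /c_ge0. Qed.

Lemma distC x y : dist x y = dist y x.
Proof. by rewrite /dist eq_sym setUC. Qed.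

Lemma dist_triangle y x z : dist x z <= dist x y + dist y z.
Proof.
have [->|xz] := eqVneq x z.
  by rewrite {1}/dist eqxx addr_ge0 ?dist_ge0.
rewrite /dist (negPf xz).
have [xy|xy] := eqVneq x y; first by rewrite -xy (negPf xz) add0r.
have [->|yz] := eqVneq y z; first by rewrite addr0.
exact: c_triangle.
Qed.

Lemma edge_weight_ge0 S F e : edges_on S F -> e \in F -> 0 <= c e.
Proof.
move=> eF /eF[c2 _].
have /cards2P[x [y [xy ->]]] : #|e| == 2%N by rewrite c2.
exact: c_ge0.
Qed.

Lemma weight_ge0 S F : edges_on S F -> 0 <= weight F.
Proof. by move=> eF; apply: sumr_ge0 => e /(edge_weight_ge0 eF). Qed.

Lemma weightS S F F' : edges_on S F' -> F \subset F' -> weight F <= weight F'.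
Proof.
move=> eF' sFF'; rewrite /weight [leRHS](big_setID F) /= (setIidPr sFF').
by rewrite lerDl sumr_ge0 // => e; rewrite inE => /andP[_ /(edge_weight_ge0 eF')].
Qed.

Lemma weightU S F F' : edges_on S F -> weight (F :|: F') <= weight F + weight F'.
Proof.
move=> eF; rewrite /weight (big_setID F') /= (setIidPr (subsetUr F F')).
rewrite setDUl setDv setU0.
by rewrite addrC lerD2r; apply: weightS eF (subsetDl _ _).
Qed.

Lemma weight_disjointU S S' F F' :
  edges_on S F -> edges_on S' F' -> [disjoint S & S'] ->
  weight (F :|: F') = weight F + weight F'.
Proof.
move=> eF eF' dS; rewrite /weight -bigU //=; last first.
  apply/pred0P=> e /=; apply/negP=> /andP[/eF[c2 eS] /eF'[_ eS']].
  have : e \subset S :&: S' by rewrite subsetI eS.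
  by rewrite (disjoint_setI0 dS) subset0 -cards_eq0 c2.
by apply: eq_bigl => e; rewrite !inE.
Qed.

Lemma weight_bridge u v S1 S2 T1 T2 : u \in S1 -> v \in S2 ->
  [disjoint S1 & S2] -> edges_on S1 T1 -> edges_on S2 T2 ->
  weight ([set u; v] |: (T1 :|: T2)) = dist u v + (weight T1 + weight T2).
Proof.
move=> uS vS dS e1 e2.
have nvS1 : v \notin S1 by rewrite (disjointFl dS).
have nuS2 : u \notin S2 by rewrite (disjointFr dS).
have uv : u != v by apply: contraNneq nvS1 => <-.
rewrite -(weight_disjointU e1 e2 dS) /weight big_setU1 /= /dist ?(negPf uv) //.
rewrite inE; apply/norP; split; apply/negP.
  by move/(edges_on_adj e1) => [_ _]; apply/negP.
by move/(edges_on_adj e2) => [_ + _]; apply/negP.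
Qed.

(** * Connecting node sets cheaply *)

(* Cycles are allowed: only the existence of a cheap connected graph matters,
   and a spanning tree is extracted from it at the very end. *)
Definition spannable S w : Prop :=
  exists F, [/\ edges_on S F, connected_on S F & weight F <= w].

Lemma spannable_le S w w' : w <= w' -> spannable S w -> spannable S w'.
Proof.
by move=> ww' [F [eF cF wF]]; exists F; split=> //; apply: le_trans wF ww'.
Qed.

Lemma spannable_ge0 S w : spannable S w -> 0 <= w.
Proof. by case=> F [eF _]; apply/le_trans/(weight_ge0 eF). Qed.

Lemma spanning_tree_spannable S T : spanning_tree S T -> spannable S (weight T).
Proof. by case=> eT cT _; exists T. Qed.

Lemma minimum_spanning_tree_le S T w :
  minimum_spanning_tree S T -> spannable S w -> weight T <= w.
Proof.
case=> _ minT [F [eF cF wF]].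
have [T' [sT'F tT']] := connected_spanning_subtree eF cF.
exact: le_trans (minT _ tT') (le_trans (weightS eF sT'F) wF).
Qed.

Lemma spannable0 : spannable set0 0.
Proof.
exists set0; split=> [e|x y|]; rewrite ?inE //.
by rewrite /weight big_set0.
Qed.

Lemma spannable1 u : spannable [set u] 0.
Proof.
exists set0; split=> [e|x y|]; rewrite ?inE //; last by rewrite /weight big_set0.
by move=> /eqP-> /eqP->.
Qed.

(** The sets may overlap; if [u = v], no edge is added and the link costs 0. *)
Lemma spannable_link u v S1 S2 w1 w2 : u \in S1 -> v \in S2 ->
  spannable S1 w1 -> spannable S2 w2 ->
  spannable (S1 :|: S2) (w1 + dist u v + w2).
Proof.
move=> uS vS [F1 [e1 c1 wF1]] [F2 [e2 c2 wF2]].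
pose E := if u == v then set0 else [set [set u; v]].
have eE : edges_on (S1 :|: S2) E.
  move=> e; rewrite /E; case: eqVneq => [_|uv]; rewrite ?inE // => /eqP->.
  by rewrite cards2 uv subUset !sub1set !inE uS vS orbT.
have wE : weight E = dist u v.
  by rewrite /weight /E /dist; case: eqVneq => _; rewrite (big_set0, big_set1).
have cE : connect (adj E) u v.
  rewrite /E; case: eqVneq => [->//|uv]; apply: connect1.
  by rewrite /adj /= inE.
exists (F1 :|: E :|: F2).
have e1' : edges_on (S1 :|: S2) F1.
  by move=> e /e1[-> es]; split=> //; apply: subset_trans es (subsetUl _ _).
have e2' : edges_on (S1 :|: S2) F2.
  by move=> e /e2[-> es]; split=> //; apply: subset_trans es (subsetUr _ _).
have eU : edges_on (S1 :|: S2) (F1 :|: E :|: F2).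
  by move=> e; rewrite !inE -orbA => /or3P[/e1'|/eE|/e2'].
split=> //.
  apply: (connect_in (x := u)) => // y; rewrite inE => /orP[yS|yS].
    apply: connect_adjS (c1 _ _ uS yS).
    by rewrite -setUA subsetUl.
  apply: (@connect_trans _ _ v).
    by apply: connect_adjS cE; rewrite setUAC subsetUr.
  by apply: connect_adjS (c2 _ _ vS yS); rewrite subsetUr.
have e1E : edges_on (S1 :|: S2) (F1 :|: E) by move=> e /setUP[/e1'|/eE].
by have := weightU F2 e1E; have := weightU E e1'; rewrite wE; lra.
Qed.

(* [stub u X t] pays for a graph on [X] and one connection from the outside
   node [u]; [tour u X t] pays for two, as a closed walk through [u] does.
   Tours from a common node concatenate, and a stub may end the chain. *)
Definition stub u X t : Prop :=
  (X = set0 /\ 0 <= t) \/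
  exists x w, [/\ x \in X, spannable X w & w + dist u x <= t].

Definition tour u X t : Prop :=
  (X = set0 /\ 0 <= t) \/
  exists x y w,
    [/\ x \in X, y \in X, spannable X w & w + dist u x + dist u y <= t].

Lemma tour0 u : tour u set0 0.
Proof. by left. Qed.

Lemma tour_stub u X t : tour u X t -> stub u X t.
Proof.
case=> [|[x [y [w [xX yX sX le_t]]]]]; [by left | right; exists x, w].
by split=> //; have := dist_ge0 u y; lra.
Qed.

Lemma stub_move u v X t : stub v X t -> stub u X (t + dist u v).
Proof.
have d0 := dist_ge0 u v.
case=> [[-> t0]|[x [w [xX sX le_t]]]]; [left | right; exists x, w]; split=> //.
  lra.
by have := dist_triangle v u x; lra.
Qed.

Lemma tour_move u v X t : tour v X t -> tour u X (t + 2 * dist u v).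
Proof.
have d0 := dist_ge0 u v.
case=> [[-> t0]|[x [y [w [xX yX sX le_t]]]]].
  by left; split=> //; lra.
right; exists x, y, w; split=> //.
by have := dist_triangle v u x; have := dist_triangle v u y; lra.
Qed.

Lemma spannable_stub u v X w :
  v \in X -> spannable X w -> stub u X (w + dist u v).
Proof. by move=> vX sX; right; exists v, w. Qed.

Lemma spannable_tour u v X w :
  v \in X -> spannable X w -> tour u X (w + 2 * dist u v).
Proof. by move=> vX sX; right; exists v, v, w; split=> //; lra. Qed.

Lemma stub_spannable u X t : stub u X t -> spannable X t.
Proof.
case=> [[-> t0]|[x [w [_ sX le_t]]]]; first exact: spannable_le spannable0.
by apply: spannable_le sX; have := dist_ge0 u x; lra.
Qed.

Lemma spannable_stubU u S X w t : u \in S ->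
  spannable S w -> stub u X t -> spannable (S :|: X) (w + t).
Proof.
move=> uS sS [[-> t0]|[x [w' [xX sX le_t]]]].
  by rewrite setU0; apply: spannable_le sS; lra.
by apply: spannable_le (spannable_link uS xX sS sX); lra.
Qed.

Lemma stub_ge0 u X t : stub u X t -> 0 <= t.
Proof. by move/stub_spannable/spannable_ge0. Qed.

(** The two connections from [u] are shortcut into one between the sets. *)
Lemma stubU_spannable u X Y t t' :
  stub u X t -> stub u Y t' -> spannable (X :|: Y) (t + t').
Proof.
move=> sX sY; have t'0 := stub_ge0 sY.
case: sX => [[-> t0]|[x [w [xX sX le_t]]]].
  by rewrite set0U; apply: spannable_le (stub_spannable sY); lra.
have := spannable_stubU xX sX (stub_move x sY).
by apply: spannable_le; rewrite distC; lra.
Qed.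

(** One leg of the tour is spent on attaching [Y]; the other remains as the stub. *)
Lemma tour_stubU u X Y t t' :
  tour u X t -> stub u Y t' -> stub u (X :|: Y) (t + t').
Proof.
move=> tX sY; have t'0 := stub_ge0 sY.
case: tX => [[-> t0]|[x [y [w [xX yX sX le_t]]]]].
  rewrite set0U; case: sY => [[-> _]|[z [w [zY sY le_t']]]].
    by left; split=> //; lra.
  by right; exists z, w; split=> //; lra.
right; exists x, (w + (t' + dist y u)); split; first by rewrite inE xX.
  exact: spannable_stubU yX sX (stub_move y sY).
by rewrite distC; lra.
Qed.

(** The last leg of the first tour and the first leg of the second are shortcut past [u]; the two
    outer legs remain. *)
Lemma tourU u X Y t t' :
  tour u X t -> tour u Y t' -> tour u (X :|: Y) (t + t').
Proof.
case=> [[-> t0]|[x [y [w [xX yX sX le_t]]]]].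
  rewrite set0U => -[[-> t'0]|[z [z' [w [zY zY' sY le_t']]]]].
    by left; split=> //; lra.
  by right; exists z, z', w; split=> //; lra.
case=> [[-> t0]|[z [z' [w' [zY zY' sY le_t']]]]].
  by rewrite setU0; right; exists x, y, w; split=> //; lra.
right; exists x, z', (w + dist y z + w').
split; rewrite ?inE ?xX ?zY' ?orbT //; first exact: spannable_link.
by have := dist_triangle u y z; rewrite (distC y u); lra.
Qed.

(** * Two-coloured spanning trees *)

(** Each tree edge [uv] is paid three times. If its ends agree in colour, one copy links their class
    and two carry the tour of the other class up to [u]. If they differ, the roles of the classes
    swap below [v]: one copy attaches the former tour as a stub, two reach the class of [v]. *)
Lemma tree_tour_bound S T u : spanning_tree S T -> u \in S ->
  forall A, u \in A -> exists w t,
    [/\ spannable (S :&: A) w, tour u (S :\: A) t & w + t <= 3 * weight T].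
Proof.
move: S T u; apply: spanning_tree_ind => [u A uA|].
  exists 0, 0; split; last by rewrite /weight big_set0; lra.
    have -> : [set u] :&: A = [set u] by apply/setIidPl; rewrite sub1set.
    exact: spannable1.
  have -> : [set u] :\: A = set0 by apply/eqP; rewrite setD_eq0 sub1set.
  exact: tour0.
move=> u v S1 S2 T1 T2 uS vS dS [e1 _ _] [e2 _ _] IH1 IH2 A uA.
rewrite (weight_bridge uS vS dS e1 e2) setIUl setDUl.
have [w1 [t1 [s1 r1 le1]]] := IH1 A uA.
have uSA : u \in S1 :&: A by rewrite inE uS.
have [vA|vA] := boolP (v \in A).
  have [w2 [t2 [s2 r2 le2]]] := IH2 A vA.
  have vSA : v \in S2 :&: A by rewrite inE vS.
  exists (w1 + dist u v + w2), (t1 + (t2 + 2 * dist u v)); split; last lra.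
    exact: spannable_link.
  exact: tourU r1 (tour_move u r2).
have [|w2 [t2 [s2 r2 le2]]] := IH2 (~: A); first by rewrite inE.
rewrite setDE setCK -setDE in s2 r2.
have vSA : v \in S2 :\: A by rewrite inE vA.
exists (w1 + (t2 + dist u v)), (t1 + (w2 + 2 * dist u v)); split; last lra.
  exact: spannable_stubU uSA s1 (stub_move u (tour_stub r2)).
exact: tourU r1 (spannable_tour u vSA s2).
Qed.

(* Giving up one of the two connections of the tour saves the weight of any
   prescribed edge [g]. *)
Lemma tree_stub_bound S T u : spanning_tree S T -> u \in S ->
  forall g A, g \in T -> u \in A -> exists w t,
    [/\ spannable (S :&: A) w, stub u (S :\: A) t
      & w + t <= 3 * weight T - c g].
Proof.
move: S T u; apply: spanning_tree_ind => [u g A|]; first by rewrite inE.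
move=> u v S1 S2 T1 T2 uS vS dS tT1 tT2 IH1 IH2 g A gT uA.
have [[e1 _ _] [e2 _ _]] := (tT1, tT2).
rewrite (weight_bridge uS vS dS e1 e2) setIUl setDUl.
have d0 := dist_ge0 u v.
have uSA : u \in S1 :&: A by rewrite inE uS.
have F1 := tree_tour_bound tT1 uS uA.
have uv : u != v by apply: contraTneq uS => ->; rewrite (disjointFl dS).
have [vA|vA] := boolP (v \in A).
  have vSA : v \in S2 :&: A by rewrite inE vS.
  have F2 := tree_tour_bound tT2 vS vA.
  (* If [g] is [uv], the second connection along it is dropped. Otherwise the subtree holding [g]
     supplies the stub that ends the chain, while the other subtree keeps its tour. *)
  case/setU1P: gT => [->|/setUP[gT|gT]].
  - have [w1 [t1 [s1 r1 le1]]] := F1; have [w2 [t2 [s2 r2 le2]]] := F2.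
    exists (w1 + dist u v + w2), (t1 + (t2 + dist u v)); split.
    + exact: spannable_link.
    + exact: tour_stubU r1 (stub_move u (tour_stub r2)).
    by move: d0; rewrite /dist (negPf uv); lra.
  - have [w1 [t1 [s1 r1 le1]]] := IH1 g A gT uA.
    have [w2 [t2 [s2 r2 le2]]] := F2.
    exists (w1 + dist u v + w2), (t2 + 2 * dist u v + t1); split; last lra.
      exact: spannable_link.
    by rewrite setUC; apply: tour_stubU (tour_move u r2) r1.
  have [w1 [t1 [s1 r1 le1]]] := F1.
  have [w2 [t2 [s2 r2 le2]]] := IH2 g A gT vA.
  exists (w1 + dist u v + w2), (t1 + (t2 + dist u v)); split; last lra.
    exact: spannable_link.
  exact: tour_stubU r1 (stub_move u r2).
have vSA : v \in S2 :\: A by rewrite inE vA.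
have vA' : v \in ~: A by rewrite inE.
have F2 := tree_tour_bound tT2 vS vA'.
have := IH2 g _ _ vA'.
rewrite setDE setCK -setDE in F2 *.
move=> {}IH2.
(* Same three cases with the colours exchanged below [v]. *)
case/setU1P: gT => [->|/setUP[gT|gT]].
- have [w1 [t1 [s1 r1 le1]]] := F1; have [w2 [t2 [s2 r2 le2]]] := F2.
  exists (w1 + (t2 + dist u v)), (t1 + (w2 + dist u v)); split.
  + exact: spannable_stubU uSA s1 (stub_move u (tour_stub r2)).
  + exact: tour_stubU r1 (spannable_stub u vSA s2).
  by move: d0; rewrite /dist (negPf uv); lra.
- have [w1 [t1 [s1 r1 le1]]] := IH1 g A gT uA.
  have [w2 [t2 [s2 r2 le2]]] := F2.
  exists (w1 + (t2 + dist u v)), (w2 + 2 * dist u v + t1); split; last lra.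
    exact: spannable_stubU uSA s1 (stub_move u (tour_stub r2)).
  by rewrite setUC; apply: tour_stubU (spannable_tour u vSA s2) r1.
have [w1 [t1 [s1 r1 le1]]] := F1.
have [w2 [t2 [s2 r2 le2]]] := IH2 gT.
exists (w1 + (t2 + dist u v)), (t1 + (w2 + dist u v)); split; last lra.
  exact: spannable_stubU uSA s1 (stub_move u r2).
exact: tour_stubU r1 (spannable_stub u vSA s2).
Qed.

(** * Joining two coloured trees across an edge *)

Section Join.

Variables (S1 S2 : {set V}) (T1 T2 : {set {set V}}) (a b : V).
Hypotheses (aS : a \in S1) (bS : b \in S2) (covS : S1 :|: S2 = [set: V]).
Hypotheses (tT1 : spanning_tree S1 T1) (tT2 : spanning_tree S2 T2).

Lemma cover_split A : A = (S1 :&: A) :|: (S2 :&: A).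
Proof. by rewrite -setIUl covS setTI. Qed.

(** All of [S2] has one colour, so [T2] is kept at cost [weight T2] and attached by a single
    crossing: directly to the class of [a], or through the stub of the other class. *)
Lemma join_mono A g : g \in T1 -> S2 \subset A ->
  exists w w', [/\ spannable A w, spannable (~: A) w'
    & w + w' <= 3 * weight T1 - c g + weight T2 + dist a b].
Proof.
move=> gT sA.
have sS2 := spanning_tree_spannable tT2.
have IA : S2 :&: A = S2 by apply/setIidPl.
have IC : S2 :&: ~: A = set0 by apply/eqP; rewrite -setDE setD_eq0.
have eA := cover_split A; rewrite IA in eA.
have eC := cover_split (~: A); rewrite IC setU0 in eC.
have [aA|aA] := boolP (a \in A).
  have [w [t [s r le]]] := tree_stub_bound tT1 aS gT aA.
  exists (w + dist a b + weight T2), t; rewrite {1}eA eC; split; last lra.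
    by apply: spannable_link => //; rewrite inE aS.
  by apply: (stub_spannable (u := a)); rewrite -setDE.
have aA' : a \in ~: A by rewrite inE.
have [w [t [s r le]]] := tree_stub_bound tT1 aS gT aA'.
rewrite setDE setCK in r.
exists (weight T2 + (t + dist b a)), w; rewrite {1}eA eC; split=> //.
  by rewrite setUC; apply: (spannable_stubU bS) => //; apply: stub_move.
by rewrite distC; lra.
Qed.

(** Each colour class crosses from [a] to [b] once. If [a] and [b] agree, one class is linked
    directly and the other by its two stubs; if not, each stub crosses to the node of its own
    colour. *)
Lemma join_both A g h : g \in T1 -> h \in T2 ->
  exists w w', [/\ spannable A w, spannable (~: A) w'
    & w + w' <= 3 * weight T1 - c g + (3 * weight T2 - c h) + 2 * dist a b].
Proof.
move=> gT hT; wlog aA : A / a \in A.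
  move=> IH; have [/IH//|aA] := boolP (a \in A).
  have [|w [w' [s s' le]]] := IH (~: A); first by rewrite inE.
  by exists w', w; rewrite setCK in s'; split=> //; rewrite addrC.
have eA := cover_split A; have eC := cover_split (~: A).
rewrite -!setDE in eC.
have [w1 [t1 [s1 r1 le1]]] := tree_stub_bound tT1 aS gT aA.
have aSA : a \in S1 :&: A by rewrite inE aS.
have [bA|bA] := boolP (b \in A).
  have [w2 [t2 [s2 r2 le2]]] := tree_stub_bound tT2 bS hT bA.
  have bSA : b \in S2 :&: A by rewrite inE bS.
  exists (w1 + dist a b + w2), (t1 + (t2 + dist a b)).
  rewrite {1}eA {1}eC; split; last lra.
    exact: spannable_link.
  exact: stubU_spannable r1 (stub_move a r2).
have bA' : b \in ~: A by rewrite inE.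
have [w2 [t2 [s2 r2 le2]]] := tree_stub_bound tT2 bS hT bA'.
rewrite setDE setCK -setDE in s2 r2.
have bSA : b \in S2 :\: A by rewrite inE bA.
exists (w1 + (t2 + dist a b)), (w2 + (t1 + dist b a)).
rewrite {1}eA {1}eC; split.
- exact: spannable_stubU aSA s1 (stub_move a r2).
- by rewrite setUC; apply: spannable_stubU bSA s2 (stub_move b r1).
by rewrite (distC b a); lra.
Qed.

End Join.

(** * Pairs and the cut *)

Lemma node_pairP x : exists i, x = p i \/ x = q i.
Proof.
have [f _ fK] := pairs_partition I.
exists (f x).1; have := fK x; case: (f x) => i [] /= ->; by [left | right].
Qed.

Definition has_whole_pair S :=
  [exists i : 'I_(npairs I), (p i \in S) && (q i \in S)].

(** A bichromatic edge joins the two trees of the solution into a connected graph on all nodes. *)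
Lemma spanning_tree_le_opt red Tr Tb T u v :
  feasible red Tr Tb -> minimum_spanning_tree [set: V] T ->
  u \in red -> v \notin red -> weight T <= weight Tr + weight Tb + dist u v.
Proof.
case=> _ tr tb mT ur vr.
apply: minimum_spanning_tree_le mT _; rewrite -(setUCr red).
have vr' : v \in ~: red by rewrite inE.
have := spannable_link ur vr' (spanning_tree_spannable tr)
  (spanning_tree_spannable tb).
by apply: spannable_le; lra.
Qed.

(** The two nodes of the pair differ in colour, so the path between them in [F] contains a
    bichromatic edge. *)
Lemma whole_pair_edge red Tr Tb T S F :
  feasible red Tr Tb -> minimum_spanning_tree [set: V] T ->
  spanning_tree S F -> has_whole_pair S ->
  exists2 g, g \in F & weight T <= weight Tr + weight Tb + c g.
Proof.
move=> feas mT [eF cF _] /existsP[i /andP[pS qS]].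
have [val _ _] := feas.
have [x [y [xS yS xr yr]]] :
    exists x y, [/\ x \in S, y \in S, x \in red & y \notin red].
  have := val i; case pr: (p i \in red) => /= qr.
    by exists (p i), (q i); split=> //; case: (q i \in red) qr.
  by exists (q i), (p i); split=> //; [case: (q i \in red) qr | rewrite pr].
have [u [v [uv ur vr]]] := crossing_edge eF cF xS yS xr yr.
exists [set u; v] => //.
have [ne _ _] := edges_on_adj eF uv.
have := spanning_tree_le_opt feas mT ur vr.
by rewrite /dist (negPf ne).
Qed.

(** If a side holds no whole pair, the partner of each of its nodes lies across the cut, and the
    colouring rule fixes the colour. *)
Lemma cut_nodes_colored VL VR red : VL :|: VR = [set: V] ->
  colors_cut_pairs VL VR red ->
  (~~ has_whole_pair VR -> VR \subset red) /\
  (~~ has_whole_pair VL -> VL \subset ~: red).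
Proof.
move=> cov col.
have LR x : (x \in VL) || (x \in VR) by rewrite -in_setU cov inE.
split=> /existsPn none; apply/subsetP=> x xS;
  have [i [ex|ex]] := node_pairP x; move: (none i) xS; rewrite ex => + xS;
  rewrite xS ?andbT /= => nS; have [h1 h2] := col i.
- by case: h2 => //; have := LR (q i); rewrite (negPf nS) orbF.
- by case: h1 => //; have := LR (p i); rewrite (negPf nS) orbF.
- by case: h1 => //; have := LR (q i); rewrite (negPf nS).
- by case: h2 => //; have := LR (p i); rewrite (negPf nS).
Qed.

(** With both ends on one side, the tree there would connect them without [e], contradicting that
    [e] is a bridge. *)
Lemma removed_edge_ends T e VL VR TL TR :
  spanning_tree [set: V] T -> e \in T -> splits_into (T :\ e) VL VR TL TR ->
  exists a b, [/\ a \in VL, b \in VR & e = [set a; b]].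
Proof.
move=> [eT _ aT] eT' [cov dis eTD tL tR].
have /cards2P[a [b [ab ee]]] : #|e| == 2%N by have [->] := eT _ eT'.
have abT : adj T a b by rewrite /adj /= -ee.
have := acyclic_bridge aT ab abT; rewrite -ee eTD => nab.
have LR x : (x \in VL) || (x \in VR) by rewrite -in_setU cov inE.
have nL : ~ (a \in VL /\ b \in VL).
  case=> aL bL; case/negP: nab; case: tL => _ cL _.
  exact: connect_adjS (subsetUl _ _) _ _ (cL _ _ aL bL).
have nR : ~ (a \in VR /\ b \in VR).
  case=> aR bR; case/negP: nab; case: tR => _ cR _.
  exact: connect_adjS (subsetUr _ _) _ _ (cR _ _ aR bR).
case/orP: (LR a) => aS; case/orP: (LR b) => bS; try by [case: nL | case: nR].
  by exists a, b.
by exists b, a; rewrite setUC.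
Qed.

End Metric.

Theorem theorem2 (R : realFieldType) (I : instance R)
    (red : {set node I}) (Tr Tb : {set {set node I}}) (opt : R) :
  algorithm_output red Tr Tb ->
  is_min_sum_opt I opt ->
  feasible red Tr Tb /\ weight Tb + weight Tr <= 3 * opt.
Proof.
case=> T [e [VL [VR [TL [TR [mT [eT maxe] spl [val col] [mr mb]]]]]]].
case=> [[red0 [Tr0 [Tb0 [feas <-]]]] _].
split; first by split=> //; [case: mr | case: mb].
have [val0 tr0 tb0] := feas.
have [a [b [aL bR ee]]] := removed_edge_ends mT.1 eT spl.
have [cov dis eTD tL tR] := spl.
have [[eL _ _] [eR _ _]] := (tL, tR).
have ab : a != b by apply: contraTneq aL => ->; rewrite (disjointFl dis).
have eE : T = [set a; b] |: (TL :|: TR) by rewrite -ee -eTD setD1K.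
have wT : weight T = dist a b + (weight TL + weight TR).
  by rewrite eE (weight_bridge aL bR dis eL eR).
have dab : dist a b = c e by rewrite /dist (negPf ab) ee.
have maxL g : g \in TL -> c g <= dist a b.
  by move=> gL; rewrite dab; apply: maxe; rewrite eE !inE gL orbT.
have maxR g : g \in TR -> c g <= dist a b.
  by move=> gR; rewrite dab; apply: maxe; rewrite eE !inE gR !orbT.
have wL0 := weight_ge0 eL; have wR0 := weight_ge0 eR.
have d0 := dist_ge0 a b.
have wr0 : 0 <= weight Tr0 by case: tr0 => /weight_ge0.
have wb0 : 0 <= weight Tb0 by case: tb0 => /weight_ge0.
have bound w w' : spannable red w -> spannable (~: red) w' ->
    weight Tb + weight Tr <= w + w'.
  by move=> s s'; rewrite addrC lerD // (minimum_spanning_tree_le mr s,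
    minimum_spanning_tree_le mb s').
have [monoR monoL] := cut_nodes_colored cov col.
have [hL|/monoL sL] := boolP (has_whole_pair VL).
  have [g gL leg] := whole_pair_edge feas mT tL hL; have := maxL g gL.
  have [hR|/monoR sR] := boolP (has_whole_pair VR).
    have [h hR' leh] := whole_pair_edge feas mT tR hR; have := maxR h hR'.
    have [w [w' [s s' le]]] := join_both aL bR cov tL tR red gL hR'.
    (* Averaging the two lower bounds and tripling leaves a slack of [dist a b - (c g + c h) / 2],
       nonnegative by maximality of [e]. *)
    by have := bound _ _ s s'; lra.
  have [w [w' [s s' le]]] := join_mono aL bR cov tL tR gL sR.
  by have := bound _ _ s s'; lra.
have [hR|/monoR sR] := boolP (has_whole_pair VR).
  have [h hR' leh] := whole_pair_edge feas mT tR hR; have := maxR h hR'.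
  have cov' : VR :|: VL = [set: node I] by rewrite setUC.
  (* Mirror image of the previous case: the sides are exchanged, and the monochromatic side [VL] is
     blue. *)
  have [w [w' [s s' le]]] := join_mono bR aL cov' tR tL hR' sL.
  rewrite setCK in s'.
  by have := bound _ _ s' s; move: le; rewrite (distC b a); lra.
(* With both sides monochromatic, the colour classes are the two sides, so [TL] and [TR] themselves
   span them. *)
have eRed : red = VR.
  apply/eqP; rewrite eqEsubset sR andbT; apply/subsetP=> x xr.
  have : x \in VL :|: VR by rewrite cov inE.
  by case/setUP=> // /(subsetP sL); rewrite inE xr.
have eBlue : ~: red = VL.
  apply/eqP; rewrite eqEsubset sL andbT eRed; apply/subsetP=> x.
  have : x \in VL :|: VR by rewrite cov inE.
  by rewrite !inE => /orP[//|->].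
have sr : spannable red (weight TR).
  by rewrite eRed; apply: spanning_tree_spannable.
have sb : spannable (~: red) (weight TL).
  by rewrite eBlue; apply: spanning_tree_spannable.
have := bound _ _ sr sb.
have [i _] := node_pairP a.
(* The lower bound is applied to all of [T]: some edge [g] gives an optimum of at least
   [weight T - c g], hence at least [weight TL + weight TR]. *)
have hV : has_whole_pair [set: node I] by apply/existsP; exists i; rewrite !inE.
have [g gT leg] := whole_pair_edge feas mT mT.1 hV.
by have := maxe g gT; rewrite -dab; lra.
Qed.
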